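(* Let $k \geq 3$ and $n \ge 2k$ be integers. Let $k' = \lfloor k/2 \rfloor$ (so $k = 2k'$ or $k = 2k'+1$), $T = 4k'+1$, $m = \lfloor n/T \rfloor$ and $\bar r = n \bmod T$. Then $$\gamma_{md}(P(n,k)) \leq \begin{cases} (3k'+1)m + \bar r & \text{if } \bar r \text{ is even},\\ (3k'+1)m + k' + \frac{\bar r + 1}{2} & \text{if } \bar r \text{ is odd}.\end{cases}$$
   Context: For integers $n$ and $k$ with $1 \le k \le n/2$, the generalized Petersen graph $P(n,k)$ has vertex set $\{v_i, u_i : 0 \le i \le n-1\}$ and edge set $\{v_i v_{(i+1) \bmod n},\ v_i u_i,\ u_i u_{(i+k) \bmod n} : 0 \le i \le n-1\}$. For a graph $G=(V,E)$, a set $S \subseteq V \cup E$ is a mixed dominating set if every element of $(V \cup E)\setminus S$ is adjacent or incident to some element of $S$ (vertices are adjacent if joined by an edge, edges are adjacent if they share an endpoint, and a vertex and an edge are incident if the vertex is an endpoint of the edge). The mixed domination number $\gamma_{md}(G)$ is the minimum size of a mixed dominating set of $G$. *)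

(* Defs.v *)
From mathcomp Require Import all_boot.

Set Implicit Arguments.
Unset Strict Implicit.
Unset Printing Implicit Defensive.

(* A graph on a finite type [V] is given by its adjacency relation [e], meant
   to be symmetric and irreflexive; an edge is the two-element set of its
   endpoints, so that parallel edges are identified. *)
Section MixedDomination.

Variables (V : finType) (e : rel V).

Definition edges : {set {set V}} :=
  [set [set p.1; p.2] | p : V * V & e p.1 p.2].

(* The disjoint union of the vertex set and the edge set, inside the finite
   type [V + {set V}]. *)
Definition vertices_edges : {set V + {set V}} :=
  [set z | match z with inl _ => true | inr f => f \in edges end].

Definition adjacent_or_incident (z w : V + {set V}) : bool :=
  match z, w with
  | inl x, inl y => e x y
  | inl x, inr f => x \in f
  | inr f, inl x => x \in f
  | inr f, inr g => (f != g) && (f :&: g != set0)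
  end.

Definition mixed_dominating (S : {set V + {set V}}) : bool :=
  (S \subset vertices_edges) &&
  [forall z in vertices_edges :\: S, exists s in S, adjacent_or_incident z s].

Lemma mixed_dominating_full : mixed_dominating vertices_edges.
Proof.
rewrite /mixed_dominating subxx setDv /=.
by apply/forall_inP => z; rewrite inE.
Qed.

(* The default value of the argmin is mixed dominating by
   [mixed_dominating_full], so this is the minimum size. *)
Definition gamma_md : nat :=
  #|[arg min_(S < vertices_edges | mixed_dominating S) #|S|]|.

Lemma gamma_md_attained : exists2 S, mixed_dominating S & #|S| = gamma_md.
Proof.
rewrite /gamma_md; case: arg_minnP => [|S domS _]; last by exists S.
exact: mixed_dominating_full.
Qed.

Lemma gamma_md_min S : mixed_dominating S -> gamma_md <= #|S|.
Proof.
rewrite /gamma_md; case: arg_minnP => [|S0 _ minS0]; last exact: minS0.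
exact: mixed_dominating_full.
Qed.

End MixedDomination.

Section GeneralizedPetersen.

Variables n k : nat.

(* [inl i] is the outer vertex v_i and [inr i] is the inner vertex u_i. *)
Definition petersen_vertex : finType := ('I_n + 'I_n)%type.

Definition petersen_arc (x y : petersen_vertex) : bool :=
  match x, y with
  | inl i, inl j => val j == (i + 1) %% n
  | inl i, inr j => i == j
  | inr i, inr j => val j == (i + k) %% n
  | inr _, inl _ => false
  end.

Definition petersen : rel petersen_vertex :=
  [rel x y | petersen_arc x y || petersen_arc y x].

Lemma petersen_sym : symmetric petersen.
Proof. by move=> x y; apply: orbC. Qed.

Lemma petersen_irr : 1 <= k -> 2 * k <= n -> irreflexive petersen.
Proof.
move=> k_gt0 le2kn; have n_gt1: 1 < n.
  by apply: leq_trans le2kn; rewrite mul2n -addnn -(addn1 1) leq_add.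
have ltkn: k < n.
  by apply: leq_trans le2kn; rewrite mul2n -addnn -addn1 leq_add2l.
have shift d (i : 'I_n) : 0 < d < n -> (val i == (i + d) %% n) = false.
  case/andP=> d_gt0 ltdn; apply/eqP=> /= eqi.
  have /eqP: i + 0 = i + d %[mod n] by rewrite addn0 -eqi modn_small.
  by rewrite eqn_modDl mod0n modn_small // eq_sym -leqn0 leqNgt d_gt0.
by case=> i; rewrite /petersen /= orbb shift // ?k_gt0 ?n_gt1.
Qed.

End GeneralizedPetersen.

Arguments petersen : clear implicits.

(* Main.v *)
(** Put [h = k %/ 2] and [T = 4 * h + 1], so that [k] is [2 * h] or [2 * h + 1].
    A set is mixed dominating as soon as the vertices that are neither in it nor
    on one of its edges are pairwise nonadjacent and each have a neighbour in
    it. Every column [{v_i, u_i}] contributes one element, except that some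
    pairs of consecutive columns contribute only the edge [v_i v_(i+1)]; the
    bound then amounts to a count of such pairs.
    The columns are read modulo [T]. Even residues [a < 2 * h] contribute the
    vertex [u_i], and two columns with residues [2 * h + a], [2 * h + a + 1]
    form a pair. The inner vertices of a pair are dominated by the [u] of the
    columns at distance [-2 * h] and [+(2 * h + 1)] from its first column,
    whichever of the two values [k] has. Near the seam between the columns
    [n - 1] and [0] a pair is kept only if its second dominator exists. All
    other columns contribute their spoke [v_i u_i]. *)

Require Import Defs.
From mathcomp Require Import all_boot.
From mathcomp Require Import zify.

Set Implicit Arguments.
Unset Strict Implicit.
Unset Printing Implicit Defensive.

(** * Domination from covered vertices *)

Section Covering.

Variables (V : finType) (e : rel V) (S : {set V + {set V}}).

Definition covered (x : V) : bool :=
  (inl x \in S) || [exists f : {set V}, (inr f \in S) && (x \in f)].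

Lemma covered_edge (f : {set V}) x : inr f \in S -> x \in f -> covered x.
Proof.
by move=> Sf xf; rewrite /covered; apply/orP; right; apply/existsP; exists f; apply/andP.
Qed.

(** An edge outside [S] has a covered endpoint, which lies in [S] or on an edge of [S] adjacent to
    it. *)
Lemma mixed_dominating_cover :
  S \subset vertices_edges e ->
  (forall x y, e x y -> covered x || covered y) ->
  (forall x, ~~ covered x -> exists2 y, e x y & inl y \in S) ->
  mixed_dominating e S.
Proof.
move=> subS cov dom; rewrite /mixed_dominating subS /=.
apply/forall_inP => -[x|f]; rewrite inE => /andP[notS zVE].
  have [|/dom[y exy Sy]] := boolP (covered x).
    rewrite /covered (negPf notS) => /existsP[f /andP[Sf xf]].
    by apply/exists_inP; exists (inr f).
  by apply/exists_inP; exists (inl y).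
have domf x : x \in f -> covered x ->
    [exists s in S, adjacent_or_incident e (inr f) s].
  move=> xf /orP[Sx|/existsP[g /andP[Sg xg]]].
    by apply/exists_inP; exists (inl x).
  apply/exists_inP; exists (inr g) => //=; apply/andP; split.
    by apply: contraNneq notS => ->.
  by apply/set0Pn; exists x; rewrite inE xf.
move: zVE; rewrite inE => /imsetP[[x y]]; rewrite inE /= => exy deff.
by have /orP[] := cov _ _ exy; apply: domf; rewrite deff !inE eqxx ?orbT.
Qed.

End Covering.

Lemma modnD_small T i d : i %% T + d < T -> (i + d) %% T = i %% T + d.
Proof. by move=> lt; rewrite -modnDml modn_small. Qed.

Lemma modn_wrap T j : T <= j < 2 * T -> j %% T = j - T.
Proof.
by move=> /andP[le lt]; rewrite -[in LHS](subnK le) modnDr modn_small //; lia.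
Qed.

Lemma modnD_wrap T i d :
  T <= i %% T + d < 2 * T -> (i + d) %% T = i %% T + d - T.
Proof. by move=> rng; rewrite -modnDml modn_wrap. Qed.

Lemma modnB_small T i d : d <= i %% T -> (i - d) %% T = i %% T - d.
Proof.
move=> le; have [->|T_gt0] := posnP T; first by rewrite !modn0.
rewrite {1}(divn_eq i T) -addnBA // modnMDl modn_small //.
by have := ltn_pmod i T_gt0; lia.
Qed.

(** * Residue pattern of the columns *)

Section Columns.

Variables h n : nat.
Hypothesis h_gt0 : 0 < h.
Hypothesis le4hn : 4 * h <= n.

Local Notation T := (4 * h + 1).

(** The bound [i + 1 < n] excludes column [n - 1]: its outer vertex is adjacent to that of column 0,
    which is a center. *)
Definition center (i : nat) : bool :=
  [&& ~~ odd (i %% T), i %% T < 2 * h & i + 1 < n].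

(** The bound [i + 2 < n] keeps column [n - 1] out of every pair, for the seam case of
    [hollow_step]. *)
Definition pair_start (i : nat) : bool :=
  [&& ~~ odd (i %% T), 2 * h <= i %% T < 4 * h, i + 2 < n
    & center ((i + (2 * h + 1)) %% n)].

Definition pair_end (i : nat) : bool := (0 < i) && pair_start i.-1.

(** These are the columns whose inner vertex is left uncovered. *)
Definition hollow (i : nat) : bool := pair_start i || pair_end i.

Lemma pair_endP i : pair_end i -> exists2 j, i = j.+1 & pair_start j.
Proof. by case: i => // j /andP[_ Pj]; exists j. Qed.

Lemma hollow_range i : hollow i -> (2 * h <= i %% T < 4 * h) && (i + 1 < n).
Proof.
case/orP=> [/and4P[_ -> lt _]|/pair_endP[j -> /and4P[ev rng lt _]]]; first by lia.
rewrite -(addn1 j) modnD_small; lia.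
Qed.

Lemma center_not_hollow i : center i -> ~~ hollow i.
Proof. by case/and3P=> _ lt _; apply/negP=> /hollow_range; lia. Qed.

Lemma pair_start_not_end i : pair_start i -> ~~ pair_end i.
Proof.
case/and4P=> ev _ _ _; apply/negP=> /pair_endP[j defi /and4P[evj rng _ _]].
by move: ev; rewrite defi -(addn1 j) modnD_small ?addn1 /= ?evj //; lia.
Qed.

Lemma center_succ i : i < n -> center i -> ~~ center ((i + 1) %% n).
Proof.
move=> ltin /and3P[ev lt ltin1]; rewrite modn_small // /center.
by rewrite modnD_small ?addn1 /= ?ev //; lia.
Qed.

(** Shifting a residue in [[2 * h, 4 * h)] by [k] gives [4 * h] or wraps modulo [T] below [2 * h].
    Across the seam the new column is [i + k - n <= k - 2 < 2 * h]. *)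
Lemma hollow_step k i : 2 * h <= k <= 2 * h + 1 -> i < n ->
  hollow i -> ~~ hollow ((i + k) %% n).
Proof.
move=> rk ltin /hollow_range Hi; apply/negP=> /hollow_range.
have [lt|le] := ltnP (i + k) n.
  rewrite [(i + k) %% n]modn_small //.
  have [small|large] := ltnP (i %% T + k) T; first by rewrite modnD_small; lia.
  by rewrite modnD_wrap; lia.
rewrite (@modn_wrap n); last by lia.
rewrite modn_small; lia.
Qed.

Lemma pair_start_left i : pair_start i -> (2 * h <= i) && center (i - 2 * h).
Proof.
case/and4P=> ev rng lt _; have le := leq_mod i T.
by rewrite /center modnB_small; lia.
Qed.

Lemma center_seam d : d < 2 * h -> ~~ odd d -> center d.
Proof. by move=> lt ev; rewrite /center modn_small ?ev ?lt; lia. Qed.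

(** * Enumeration of the pairs, [h] to a full block of [T] columns *)

Definition pair_index (c : nat) : nat :=
  c %/ h * T + (2 * h + 2 * (c %% h)).

Lemma pair_index_div c : pair_index c %/ T = c %/ h.
Proof.
have ltc := ltn_pmod c h_gt0; rewrite /pair_index divnMDl; last by lia.
by rewrite [X in _ + X]divn_small ?addn0 //; lia.
Qed.

Lemma pair_index_inj : injective pair_index.
Proof.
move=> c d eqcd; have := congr1 (divn^~ T) eqcd; rewrite !pair_index_div => eqdiv.
move: eqcd; rewrite /pair_index eqdiv => /addnI eqcd.
by rewrite (divn_eq c h) (divn_eq d h) eqdiv; congr (_ + _); lia.
Qed.

(** For odd [n %% T], a right dominator wrapping from the last full block lands on an odd column, so
    that block keeps a pair only if its dominator precedes column [n - 1]. Any excess of the last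
    summand over [h] counts pairs in the partial block. *)
Definition pair_count : nat :=
  if ~~ odd (n %% T) then h * (n %/ T)
  else h * (n %/ T - 1) + (n %% T - 1) %/ 2.

Lemma pair_index_start c : c < pair_count -> pair_start (pair_index c).
Proof.
rewrite /pair_count /pair_index => ltc.
have ltd := ltn_pmod c h_gt0; have ltr : n %% T < T by rewrite ltn_pmod //; lia.
have defc := divn_eq c h; have defn := divn_eq n T.
set q := c %/ h in defc *; set d := c %% h in ltd defc *.
set m := n %/ T in defn ltc; set r := n %% T in defn ltc ltr.
move: q d m r defc ltd defn ltr ltc => q d m r defc ltd defn ltr ltc.
have modi : (q * T + (2 * h + 2 * d)) %% T = 2 * h + 2 * d.
  by rewrite modnMDl modn_small //; lia.
suff [lt cen]: q * T + (2 * h + 2 * d) + 2 < n /\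
    center ((q * T + (2 * h + 2 * d) + (2 * h + 1)) %% n).
  rewrite /pair_start modi lt cen; lia.
have -> : q * T + (2 * h + 2 * d) + (2 * h + 1) = (q + 1) * T + 2 * d by lia.
have cenT : 2 * d + (q + 1) * T + 1 < n ->
    center (((q + 1) * T + 2 * d) %% n).
  move=> lt; rewrite modn_small; last by lia.
  by rewrite /center modnMDl modn_small; lia.
have [ltq|leq] := ltnP (q + 1) m.
  have : (q + 2) * T <= m * T by rewrite leq_mul2r; lia.
  by move=> leqm; split; [|apply: cenT]; lia.
have [eqq|neq] := eqVneq (q + 1) m.
  have eqqT : (q + 1) * T = m * T by rewrite eqq.
  split; first by lia.
  have [lt|ge] := ltnP (2 * d + 1) r; first by apply: cenT; lia.
  move: ltc; case: ifP => [evr _|odr].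
    (* As [r] is even, [2 * d >= r], and the wrapped column [2 * d - r] is even. *)
    rewrite (@modn_wrap n); last by lia.
    by apply: center_seam; lia.
  have eqm : m - 1 = q by lia.
  by rewrite eqm mulnC; lia.
(* Here [m <= q], so the pair lies beyond the full blocks and [r] must be odd. *)
have : ~~ (c < h * m).
  have : m * h <= q * h by rewrite leq_mul2r; lia.
  lia.
move: ltc; case: ifP => [_ -> //|odr] ltc cm.
(* Otherwise [n = r = 4 * h], which is even. *)
have m_gt0 : 0 < m.
  rewrite lt0n; apply/eqP=> m0; move: defn; rewrite m0; lia.
have eqhm : h * m = h * (m - 1) + h by rewrite addnC -mulnS; congr (_ * _); lia.
(* Since [(r - 1) %/ 2 < 2 * h], the count ends before block [m + 1]. *)
have eqm : q = m.
  have : ~~ (m + 1 <= q).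
    apply/negP=> ltmq.
    have : (m + 1) * h <= q * h by rewrite leq_mul2r ltmq orbT.
    lia.
  lia.
rewrite eqm in defc *.
split; first by lia.
rewrite (@modn_wrap n); last by lia.
by apply: center_seam; lia.
Qed.

(** * The set and its size *)

Let n_gt0 : 0 < n. Proof. lia. Qed.

Definition column (i : nat) : 'I_n := Ordinal (ltn_pmod i n_gt0).

Local Notation vertex := (petersen_vertex n).

Definition outer (i : 'I_n) : vertex := inl i.
Definition inner (i : 'I_n) : vertex := inr i.

Definition column_elt (i : 'I_n) : vertex + {set vertex} :=
  if center i then inl (inner i)
  else if pair_start i then inr [set outer i; outer (column (i + 1))]
  else inr [set outer i; inner i].

Definition petersen_mds : {set vertex + {set vertex}} :=
  column_elt @: [set i : 'I_n | ~~ pair_end i].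

Local Notation S := petersen_mds.

Lemma mds_center (i : 'I_n) : center i -> inl (inner i) \in S.
Proof.
move=> ci; apply/imsetP; exists i; last by rewrite /column_elt ci.
by rewrite inE; have := center_not_hollow ci; rewrite negb_or => /andP[].
Qed.

Lemma mds_pair (i : 'I_n) : pair_start i ->
  inr [set outer i; outer (column (i + 1))] \in S.
Proof.
move=> Pi; apply/imsetP; exists i; first by rewrite inE pair_start_not_end.
rewrite /column_elt Pi ifN //; apply/negP=> /center_not_hollow.
by rewrite /hollow Pi.
Qed.

Lemma mds_spoke (i : 'I_n) : ~~ center i -> ~~ hollow i ->
  inr [set outer i; inner i] \in S.
Proof.
move=> ci; rewrite negb_or => /andP[Pi Ei]; apply/imsetP.
by exists i; rewrite ?inE // /column_elt (negPf ci) (negPf Pi).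
Qed.

Lemma covered_outer (i : 'I_n) : ~~ center i -> covered S (outer i).
Proof.
move=> ci; have [|nh] := boolP (hollow i); last first.
  by apply: (covered_edge (mds_spoke ci nh)); rewrite !inE eqxx.
case/orP=> [Pi|/pair_endP[j defi Pj]].
  by apply: (covered_edge (mds_pair Pi)); rewrite !inE eqxx.
have ltin := ltn_ord i; have ltjn : j < n by lia.
have Pj' : pair_start (Ordinal ltjn) by [].
have -> : i = column (j + 1).
  by apply: val_inj; rewrite /= modn_small addn1 -defi.
by apply: (covered_edge (mds_pair Pj')); rewrite !inE eqxx orbT.
Qed.

Lemma covered_inner (i : 'I_n) : ~~ hollow i -> covered S (inner i).
Proof.
move=> nh; have [ci|ci] := boolP (center i).
  by rewrite /covered mds_center.
by apply: (covered_edge (mds_spoke ci nh)); rewrite !inE eqxx orbT.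
Qed.

(** The second column of each pair contributes nothing, and the enumeration yields [pair_count]
    distinct such columns. *)
Lemma card_petersen_mds : #|S| <= n - pair_count.
Proof.
apply: leq_trans (leq_imset_card _ _) _.
have -> : [set i : 'I_n | ~~ pair_end i] = ~: [set i : 'I_n | pair_end i].
  by apply/setP=> i; rewrite !inE.
rewrite cardsCs setCK card_ord leq_sub2l //.
pose f (c : 'I_(pair_count)) := column (pair_index c).+1.
have valf c : val (f c) = (pair_index c).+1.
  have /and4P[_ _ lt _] := pair_index_start (ltn_ord c).
  by rewrite /= modn_small //; lia.
have injf : injective f.
  move=> c d /(congr1 val); rewrite !valf => -[eqcd].
  by apply: val_inj; apply: pair_index_inj eqcd.
rewrite -[leqLHS]card_ord -cardsT -(card_imset _ injf); apply: subset_leq_card.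
apply/subsetP=> _ /imsetP[c _ ->]; rewrite inE valf.
exact: pair_index_start.
Qed.

(** * Domination for both values of [k] *)

Variable k : nat.
Hypothesis rk : 2 * h <= k <= 2 * h + 1.

Lemma mds_subset : S \subset vertices_edges (petersen n k).
Proof.
apply/subsetP=> z /imsetP[i _ ->]; rewrite inE /column_elt.
case: ifP => // _; case: ifP => _; apply/imsetP.
  by exists (outer i, outer (column (i + 1))); rewrite // inE /petersen /= eqxx.
by exists (outer i, inner i); rewrite // inE /petersen /= eqxx.
Qed.

(** Only outer vertices of centers and inner vertices of hollow columns can be uncovered; the three
    kinds of edges are treated in turn. *)
Lemma covered_arc x y : petersen_arc k x y -> covered S x || covered S y.
Proof.
case: x y => i [] j //=.
- move=> /eqP defj; have [ci|/covered_outer->//] := boolP (center i).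
  by rewrite [X in _ || X]covered_outer ?orbT // defj center_succ.
- move=> /eqP <-; have [ci|/covered_outer->//] := boolP (center i).
  by rewrite [X in _ || X]covered_inner ?orbT // center_not_hollow.
- move=> /eqP defj; have [hi|/covered_inner->//] := boolP (hollow i).
  by rewrite [X in _ || X]covered_inner ?orbT // defj hollow_step.
Qed.

Lemma inner_step (i j : 'I_n) : val j = (i + k) %% n ->
  petersen n k (inner i) (inner j).
Proof. by move=> defj; rewrite /petersen /= defj eqxx. Qed.

(** For [k = 2 * h] the first column of a pair uses its left dominator and the second its right one;
    for [k = 2 * h + 1] the roles swap. *)
Lemma hollow_dominated (i : 'I_n) : hollow i ->
  exists2 j : 'I_n, petersen n k (inner i) (inner j) & center j.
Proof.
have ltin := ltn_ord i.
have right: center ((i + k) %% n) ->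
    exists2 j : 'I_n, petersen n k (inner i) (inner j) & center j.
  by move=> cr; exists (column (i + k)) => //; apply: inner_step.
have left: k <= i -> center (i - k) ->
    exists2 j : 'I_n, petersen n k (inner i) (inner j) & center j.
  move=> leki cl; have lt : i - k < n by lia.
  exists (Ordinal lt) => //; rewrite petersen_sym; apply: inner_step.
  by rewrite /= subnK // modn_small.
case/orP=> [Pi|/pair_endP[j defi Pj]].
  have /andP[le2h cl] := pair_start_left Pi.
  have [ek|nk] := eqVneq k (2 * h); first by apply: left; rewrite ek.
  have ek : k = 2 * h + 1 by lia.
  by apply: right; rewrite ek; case/and4P: Pi.
have /andP[le2h cl] := pair_start_left Pj.
have [ek|nk] := eqVneq k (2 * h).
  apply: right; case/and4P: Pj => _ _ _.
  by have <- : j + (2 * h + 1) = i + k by lia.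
apply: left; first by lia.
by have -> : i - k = j - 2 * h by lia.
Qed.

Lemma petersen_mds_dominating : mixed_dominating (petersen n k) S.
Proof.
apply: mixed_dominating_cover => [|x y|[i|i] nc]; first exact: mds_subset.
- by case/orP=> /covered_arc //; rewrite orbC.
- have [ci|/covered_outer ci] := boolP (center i); last by rewrite ci in nc.
  by exists (inner i); rewrite ?mds_center // /petersen /= eqxx.
have [hi|/covered_inner ci] := boolP (hollow i); last by rewrite ci in nc.
by have [j eij cj] := hollow_dominated hi; exists (inner j) => //; apply: mds_center.
Qed.

End Columns.

(** * The final count *)

Theorem theorem3 (n k : nat) (hk : 3 <= k) (hn : 2 * k <= n) :
  let k' := k %/ 2 in
  let T := 4 * k' + 1 in
  let m := n %/ T in
  let r := n %% T in
  gamma_md (petersen n k) <=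
    if ~~ odd r then (3 * k' + 1) * m + r
    else (3 * k' + 1) * m + k' + (r + 1) %/ 2.
Proof.
cbv zeta; set h := k %/ 2; set T := 4 * h + 1; set m := n %/ T; set r := n %% T.
have h_gt0 : 0 < h by rewrite /h; lia.
have rk : 2 * h <= k <= 2 * h + 1 by rewrite /h; lia.
have le4hn : 4 * h <= n by lia.
apply: leq_trans (gamma_md_min (petersen_mds_dominating h_gt0 le4hn rk)) _.
apply: leq_trans (card_petersen_mds h_gt0 le4hn) _.
rewrite /pair_count -/T -/m -/r.
have defn : n = m * T + r := divn_eq n T.
have ltr : r < T by rewrite ltn_pmod // /T; lia.
have m_gt0 : odd r -> 0 < m.
  by move=> odr; rewrite lt0n; apply/eqP=> m0; move: defn; rewrite m0 /T in ltr *; lia.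
have defmT : m * T = h * m * 4 + m by rewrite /T; lia.
have -> : (3 * h + 1) * m = h * m * 3 + m by lia.
(* For odd [r], one block's [h] pairs are given up and [(r - 1) %/ 2] regained, whence
   [h + (r + 1) %/ 2]. *)
case: ifP => [evr|odr]; first by lia.
have : h * m = h * (m - 1) + h.
  by rewrite addnC -mulnS; congr (_ * _); move: m_gt0; case: odd odr => // _ /(_ isT); lia.
lia.
Qed.
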